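(* Let $p,q\geq0$ be integers and let $X_1,\ldots,X_p,Y_1,\ldots,Y_q$ be independent random variables with values in $\{0,1,2,\ldots\}$ such that $P(X_i=j)=p_j$ for all $i$ and $j\geq0$, and $P(Y_i=j)=q_j$ for all $i$ and $j\geq0$. Let $S_{p,q}=X_1+\cdots+X_p+Y_1+\cdots+Y_q$. Then for every integer $n\geq0$, $$P(S_{p,q}=n)=\frac{p!}{(n+p)!}B^{(q)}_{n+p+q,\,p+q}\big(1!\,p_0,2!\,p_1,3!\,p_2,\ldots;\ 0!\,q_0,1!\,q_1,2!\,q_2,\ldots\big),$$ i.e. the arguments are $a_l=l!\,p_{l-1}$ and $b_l=(l-1)!\,q_{l-1}$ for $l\geq1$.
   Context: For sequences $a=(a_l)_{l\geq1}$, $b=(b_l)_{l\geq1}$ and integers $N,K,r\geq0$, the partial $r$-Bell polynomial is $$B^{(r)}_{N,K}(a_1,a_2,\ldots;b_1,b_2,\ldots)=\sum_{\pi}\ \prod_{B\in\pi,\ B\cap\{1,\ldots,r\}=\emptyset}a_{|B|}\prod_{B\in\pi,\ B\cap\{1,\ldots,r\}\neq\emptyset}b_{|B|},$$ where $\pi$ ranges over the partitions of $\{1,\ldots,N\}$ into exactly $K$ nonempty blocks such that $1,\ldots,r$ lie in pairwise distinct blocks (an empty sum is $0$; the empty partition of the empty set contributes $1$). Note that $p$ denotes the number of variables $X_i$ while $p_j$ denotes probabilities. *)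

(* Defs.v *)
From HB Require Import structures.
From mathcomp Require Import all_boot all_order all_algebra.

Set Implicit Arguments.
Unset Strict Implicit.
Unset Printing Implicit Defensive.

Import Order.TTheory GRing.Theory Num.Theory.

Local Open Scope ring_scope.

(* The element k of {1, ..., N} is represented by the ordinal k - 1 : 'I_N, so
   {1, ..., r} becomes the set of ordinals smaller than r. *)
Definition first_ords (N r : nat) : {set 'I_N} := [set i : 'I_N | (i < r)%N].

(* The guard r <= N says that 1, ..., r are all elements of {1, ..., N}. *)
Definition r_separated (N r : nat) (pi : {set {set 'I_N}}) : bool :=
  (r <= N)%N &&
  [forall i in first_ords N r, forall j in first_ords N r,
     (i != j) ==> (pblock pi i != pblock pi j)].

(* a and b are indexed from 1: a 0 and b 0 are never used, since the blocks of
   a partition are nonempty. *)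
Definition rBell (R : comNzRingType) (N K r : nat) (a b : nat -> R) : R :=
  \sum_(pi : {set {set 'I_N}} |
        [&& partition pi [set: 'I_N], #|pi| == K & r_separated r pi])
    (\prod_(B in pi | B :&: first_ords N r == set0) a #|B|) *
    (\prod_(B in pi | B :&: first_ords N r != set0) b #|B|).

(* These come after the combinatorial part because the notions on [set T] shadow
   the homonymous ones on [{set T}] (set0, pblock, partition). *)
From mathcomp Require Import all_classical all_reals all_analysis.

Local Open Scope classical_set_scope.

Definition mutually_independent (d d' : measure_display) (T : measurableType d)
    (T' : measurableType d') (R : realType) (P : probability T R)
    (I : finType) (Z : I -> {RV P >-> T'}) : Prop :=
  forall (J : {set I}) (A : I -> set T'),
    (forall i, i \in J -> measurable (A i)) ->
    (P (\bigcap_(i in [set` J]) (Z i @^-1` A i)) =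
     \prod_(i in J) P (Z i @^-1` A i))%E.

Definition join_families (V I J : Type) (X : I -> V) (Y : J -> V) (k : I + J) : V :=
  match k with inl i => X i | inr j => Y j end.

(* Main.v *)
(* Both sides are the coefficient of X^n in A^p B^q, with A and B the (truncated)
   generating polynomials of the laws of X_i and Y_j.  For the probability this is
   independence, after splitting {S = n} according to the values of all the
   variables.  On the combinatorial side, p! B^(q)_{n+p+q,p+q} counts labellings h
   of the n+p elements other than 1, ..., q by p + q labels, with weights depending
   only on the fiber sizes.  Summing prod_y |h^-1(y)|! [X^|h^-1(y)|] G_y over all
   labellings h of an m-element set gives m! [X^m] prod_y G_y, by induction on m:
   fixing the label of one element differentiates the corresponding factor.  Take
   G_y = X A for p labels, where the factor X makes the fibers nonempty, and
   G_y = B for the q others. *)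
Require Import Defs.
From HB Require Import structures.
From mathcomp Require Import all_boot all_fingroup all_order all_algebra.

Set Implicit Arguments.
Unset Strict Implicit.
Unset Printing Implicit Defensive.

Import Order.TTheory GRing.Theory Num.Theory.

Local Open Scope ring_scope.

(** * Fiber-weighted sums over labellings as coefficients of products *)

Lemma cards_pred_sum (T : finType) (A : pred T) :
  #|[set x | A x]| = (\sum_x A x)%N.
Proof. by rewrite -sum1dep_card big_mkcond; apply: eq_bigr => x _; case: (A x). Qed.

Lemma card_fiber_recl (I : finType) (m : nat) (h : 'I_m.+1 -> I) (i : I) :
  #|[set x | h x == i]| =
  ((h ord0 == i) + #|[set x | h (lift ord0 x) == i]|)%N.
Proof. by rewrite !cards_pred_sum big_ord_recl. Qed.

Lemma deriv_prod (R : comNzRingType) (I : finType) (G : I -> {poly R}) :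
  (\prod_i G i)^`() =
  \sum_j \prod_i (if i == j then (G i)^`() else G i).
Proof.
(* The induction runs over duplicate-free sequences, so that the test [i == j] selects exactly one
   factor. *)
have H (s : seq I) : uniq s -> (\prod_(i <- s) G i)^`() =
  \sum_(j <- s) \prod_(i <- s) (if i == j then (G i)^`() else G i).
  elim: s => [|j s IHs] /= => [_|/andP[jNs us]].
    by rewrite !big_nil -[1]/(1%:P) derivC.
  rewrite !big_cons derivM eqxx IHs //; congr (_ + _).
    congr (_ * _); apply: eq_big_seq => i si.
    by case: eqP => // ij; rewrite -ij si in jNs.
  rewrite big_distrr /=; apply: eq_big_seq => k sk.
  rewrite big_cons; case: eqP => // jk.
  by rewrite jk sk in jNs.
by rewrite (H _ (index_enum_uniq I)).
Qed.

Lemma sum_fibers_coef (R : comNzRingType) (I : finType) (m : nat)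
    (G : I -> {poly R}) :
  \sum_(h : {ffun 'I_m -> I})
     \prod_i ((G i)`_#|[set x | h x == i]| *+ #|[set x | h x == i]|`!) =
  (\prod_i G i)`_m *+ m`!.
Proof.
elim: m G => [|m IHm] G.
  rewrite (big_pred1 (ffun0 (card_ord 0))) => [|h]; last first.
    by apply/esym/eqP/ffunP => -[].
  rewrite mulr1n -horner_coef0 horner_prod; apply: eq_bigr => i _.
  rewrite (_ : [set x | _] = set0) ?cards0 ?mulr1n ?horner_coef0 //.
  by apply/setP => -[].
(* A factor [m.+1] of the factorial turns the coefficient of index [m.+1] into that of index [m] of
   the derivative. *)
rewrite factS mulrnA -coef_deriv deriv_prod coef_sum -sumrMnl.
under [RHS]eq_bigr => j _ do rewrite -IHm.
rewrite pair_big /=.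
(* A labelling of [m.+1] elements amounts to the label of [ord0] and a labelling of the rest. *)
pose c (u : I * {ffun 'I_m -> I}) : {ffun 'I_m.+1 -> I} :=
  [ffun x => if unlift ord0 x is Some y then u.2 y else u.1].
have cK : bijective c.
  exists (fun h : {ffun 'I_m.+1 -> I} => (h ord0, [ffun y => h (lift ord0 y)])).
    move=> [j h]; rewrite /c ffunE unlift_none /=; congr (_, _).
    by apply/ffunP => y; rewrite !ffunE liftK.
  move=> h; apply/ffunP => x; rewrite ffunE /=.
  by case: unliftP => [y|] ->; rewrite ?ffunE.
rewrite (reindex c) /=; last exact: onW_bij.
apply: eq_bigr => -[j h] _ /=; apply: eq_bigr => i _.
rewrite card_fiber_recl {1 3}/c ffunE unlift_none /= eq_sym.
rewrite (_ : [set x | _] = [set x | h x == i]); last first.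
  by apply/setP => x; rewrite !inE /c ffunE liftK.
by case: eqP => _ //; rewrite add1n coef_deriv factS mulrnA.
Qed.

(** * Partitions with separated elements as fibers of labellings *)

Section LabelledPartitions.

Variables (p q m : nat).
Implicit Types (h : {ffun 'I_m -> 'I_p + 'I_q}) (pi : {set {set 'I_(q + m)}}).

(** Giving the first [q] elements the fixed distinct labels [inr j] builds their separation into the
    labelling. *)
Definition extend_label h (x : 'I_(q + m)) : 'I_p + 'I_q :=
  match split x with inl j => inr j | inr y => h y end.

Definition fiber h (y : 'I_p + 'I_q) : {set 'I_(q + m)} :=
  [set x | extend_label h x == y].

Definition fibers h := [set fiber h y | y : 'I_p + 'I_q].

(** This makes every extended fiber nonempty, since the one over [inr j] always contains
    [lshift m j]. *)
Definition covers_inl h := [forall i, inl i \in codom h].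

Definition Bell_partition pi :=
  [&& partition pi [set: 'I_(q + m)], #|pi| == (p + q)%N & r_separated q pi].

Lemma extend_label_lshift h j : extend_label h (lshift m j) = inr j.
Proof. by rewrite /extend_label (unsplitK (inl j)). Qed.

Lemma extend_label_rshift h y : extend_label h (rshift q y) = h y.
Proof. by rewrite /extend_label (unsplitK (inr y)). Qed.

Lemma mem_first_ords (x : 'I_(q + m)) :
  reflect (exists j, x = lshift m j) (x \in first_ords (q + m) q).
Proof.
rewrite inE; apply: (iffP idP) => [xq|[j ->]]; last by rewrite /= ltn_ord.
by exists (Ordinal xq); apply: val_inj.
Qed.

Lemma fiber_mem h x y : (x \in fiber h y) = (extend_label h x == y).
Proof. by rewrite inE. Qed.

Lemma fiber_eq h x y z : x \in fiber h y -> fiber h y = fiber h z -> y = z.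
Proof.
by move=> xy yz; move: (xy); rewrite {1}yz !inE in xy * => /eqP <-; apply/eqP.
Qed.

Lemma fiber_inr h j : lshift m j \in fiber h (inr j).
Proof. by rewrite inE extend_label_lshift. Qed.

Lemma fiber_nonempty h y : covers_inl h -> exists x, x \in fiber h y.
Proof.
move=> /forallP ch; case: y => [i|j]; last by exists (lshift m j); apply: fiber_inr.
have /codomP[y hy] := ch i.
by exists (rshift q y); rewrite inE extend_label_rshift hy.
Qed.

Lemma fiber_inj h : covers_inl h -> injective (fiber h).
Proof. by move=> ch y z; have [x xy] := fiber_nonempty y ch; apply: fiber_eq xy. Qed.

Lemma fibers_partition h :
  covers_inl h -> partition (fibers h) [set: 'I_(q + m)].
Proof.
move=> ch; apply/and3P; split.
- apply/eqP/setP => x; rewrite inE; apply/bigcupP.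
  exists (fiber h (extend_label h x)); first exact: imset_f.
  by rewrite inE.
- apply/trivIsetP => _ _ /imsetP[y _ ->] /imsetP[z _ ->] yz.
  rewrite -setI_eq0; apply/set0Pn => -[x]; rewrite !inE => /andP[/eqP xy /eqP xz].
  by rewrite -xy xz eqxx in yz.
- apply/imsetP => -[y _ /esym/eqP y0].
  by have [x xy] := fiber_nonempty y ch; rewrite (eqP y0) inE in xy.
Qed.

Lemma fiber_inl_disjoint h i : fiber h (inl i) :&: first_ords (q + m) q == set0.
Proof.
rewrite setI_eq0; apply/pred0P => x /=; apply/negP => /andP[].
by rewrite fiber_mem => xi /mem_first_ords[j xj]; rewrite xj extend_label_lshift in xi.
Qed.

Lemma fiber_inr_meets h j : fiber h (inr j) :&: first_ords (q + m) q != set0.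
Proof.
apply/set0Pn; exists (lshift m j); rewrite inE fiber_inr.
by apply/mem_first_ords; exists j.
Qed.

Lemma fibers_Bell h : covers_inl h -> Bell_partition (fibers h).
Proof.
move=> ch; have ph := fibers_partition ch; have /and3P[_ tr _] := ph.
apply/and3P; split=> //.
  by rewrite card_imset ?cardsT; [rewrite card_sum !card_ord | exact: fiber_inj].
rewrite /r_separated leq_addr /=.
have pb j : pblock (fibers h) (lshift m j) = fiber h (inr j).
  by apply: def_pblock; [|exact: imset_f|exact: fiber_inr].
apply/forall_inP => _ /mem_first_ords[i ->].
apply/forall_inP => _ /mem_first_ords[j ->].
rewrite !pb; apply/implyP; apply: contra_neq => /(fiber_inj ch)[->] //.
Qed.

Lemma card_fiber h y :
  #|fiber h y| =
  (\sum_j (extend_label h (lshift m j) == y) + #|[set x | h x == y]|)%N.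
Proof.
rewrite !cards_pred_sum big_split_ord /=; congr (_ + _)%N.
by apply: eq_bigr => x _; rewrite extend_label_rshift.
Qed.

(** Blocks meeting the first [q] elements are exactly the fibers over labels [inr j]. Each contains
    one such element, [lshift m j], whence the successor in the argument of [b]. *)
Lemma fibers_weight (R : comNzRingType) (a b : nat -> R) h :
  covers_inl h ->
  (\prod_(B in fibers h | B :&: first_ords (q + m) q == set0) a #|B|) *
  (\prod_(B in fibers h | B :&: first_ords (q + m) q != set0) b #|B|) =
  (\prod_i a #|[set x | h x == inl i]|) *
  (\prod_j b #|[set x | h x == inr j]|.+1).
Proof.
move=> ch; have finj := fiber_inj ch.
rewrite !big_mkcondr !big_imset /=; try by move=> y z _ _; apply: finj.
rewrite !big_sumType /=.
under eq_bigr => i _ do rewrite fiber_inl_disjoint.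
rewrite [X in _ * X * _]big1 ?mulr1; last first.
  by move=> j _; rewrite (negPf (fiber_inr_meets h j)).
rewrite [X in _ * (X * _)]big1 ?mul1r; last first.
  by move=> i _; rewrite fiber_inl_disjoint.
congr (_ * _); apply: eq_bigr => k _.
  by rewrite card_fiber big1 // => j _; rewrite extend_label_lshift.
rewrite fiber_inr_meets card_fiber (bigD1 k) //= extend_label_lshift eqxx.
rewrite big1 // => j jk; rewrite extend_label_lshift.
by case: eqP => // -[jk']; rewrite jk' eqxx in jk.
Qed.

(** The symmetric group on the labels [inl] acts freely on these labellings because each such label
    is attained, and transitively because the first [q] elements pin the labels [inr]. *)
Lemma card_fibers_eq h0 :
  covers_inl h0 ->
  #|[set h | covers_inl h & fibers h == fibers h0]| = p`!.
Proof.
move=> ch0; rewrite -card_Sn -cardsT.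
pose act (s : 'S_p) : {ffun 'I_m -> 'I_p + 'I_q} :=
  [ffun x => match h0 x with inl i => inl (s i) | inr j => inr j end].
have act_inj : injective act.
  move=> s t st; apply/permP => i.
  have /codomP[x hx] := forallP ch0 i.
  by move/ffunP/(_ x): st; rewrite !ffunE -hx => -[].
rewrite -(card_imset [set: 'S_p] act_inj); apply: eq_card => h; rewrite !inE.
apply/andP/imsetP => [[ch /eqP hh0]|[s _ ->]].
- have /fin_all_exists[s sP] i : exists k, fiber h (inl k) = fiber h0 (inl i).
    (* A fiber of [h] over [inr j] is excluded: it contains [lshift m j], which [h0] also sends to
       [inr j]. *)
    have /imsetP[[k|j] _ hk] : fiber h0 (inl i) \in fibers h.
      by rewrite hh0 imset_f.
      by exists k.
    have := fiber_inr h j.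
    by rewrite -hk fiber_mem extend_label_lshift.
  have s_inj : injective s.
    move=> i k ik; have := sP i; rewrite ik sP => /(fiber_inj ch0)[] //.
  exists (perm s_inj) => //; apply/ffunP => x; rewrite ffunE.
  have xh0 : rshift q x \in fiber h0 (h0 x).
    by rewrite fiber_mem extend_label_rshift.
  case E: (h0 x) xh0 => [i|j] xh0.
    by move: xh0; rewrite -sP fiber_mem extend_label_rshift permE => /eqP.
  have /imsetP[z _ hz] : fiber h0 (inr j) \in fibers h by rewrite hh0 imset_f.
  have := fiber_inr h0 j; rewrite hz fiber_mem extend_label_lshift => /eqP jz.
  by move: xh0; rewrite hz fiber_mem extend_label_rshift -jz => /eqP.
- have fiber_act_inl i : fiber (act s) (inl (s i)) = fiber h0 (inl i).
    apply/setP => x; rewrite !fiber_mem /extend_label; case: (split x) => // y.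
    rewrite ffunE; case: (h0 y) => // k.
    by rewrite !(inj_eq (@inl_inj _ _)) (inj_eq perm_inj).
  have fiber_act_inr j : fiber (act s) (inr j) = fiber h0 (inr j).
    apply/setP => x; rewrite !fiber_mem /extend_label; case: (split x) => // y.
    by rewrite ffunE; case: (h0 y).
  split.
    apply/forallP => i; have /codomP[x hx] := forallP ch0 ((s^-1)%g i).
    by apply/codomP; exists x; rewrite ffunE -hx permKV.
  apply/eqP/setP => B; apply/imsetP/imsetP => -[[i|j] _ ->].
  + by exists (inl ((s^-1)%g i)); rewrite // -fiber_act_inl permKV.
  + by exists (inr j).
  + by exists (inl (s i)).
  + by exists (inr j).
Qed.

(** The blocks missing the first [q] elements are numbered arbitrarily, the others by the element
    they contain; each element is then labelled by its block. *)
Lemma Bell_partition_fibers pi :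
  Bell_partition pi -> exists2 h, covers_inl h & fibers h = pi.
Proof.
case/and3P => ppi /eqP cpi /andP[_ sep]; have /and3P[/eqP cov tr s0] := ppi.
have incov x : x \in cover pi by rewrite cov inE.
pose special j := pblock pi (lshift m j).
have special_inj : injective special.
  move=> i j ij; apply/eqP/negPn/negP => nij.
  have first k : lshift m k \in first_ords (q + m) q.
    by apply/mem_first_ords; exists k.
  have /forall_inP/(_ _ (first j)) := forall_inP sep _ (first i).
  by rewrite (inj_eq (@lshift_inj _ _)) nij /= -/(special i) -/(special j) ij eqxx.
pose S := [set special j | j : 'I_q].
have S_pi : S \subset pi by apply/subsetP => _ /imsetP[j _ ->]; apply: pblock_mem.
(* Separation makes [special] injective, so [q] of the [p + q] blocks are special. *)
have cS : #|pi :\: S| = p.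
  apply/eqP; rewrite -(eqn_add2l #|S|) -{1}(setIidPr S_pi) cardsID cpi.
  by rewrite card_imset // card_ord addnC.
pose block (y : 'I_p + 'I_q) : {set 'I_(q + m)} :=
  match y with inl i => enum_val (cast_ord (esym cS) i) | inr j => special j end.
have block_inl i : block (inl i) \in pi :\: S by apply: enum_valP.
have block_pi y : block y \in pi.
  case: y => [i|j]; last exact: pblock_mem.
  by have := block_inl i; rewrite inE => /andP[].
have block_inj : injective block.
  move=> [i|j] [k|l] => [/enum_val_inj/cast_ord_inj -> //|||/special_inj -> //] /= E.
    by have := block_inl i; rewrite /= E inE imset_f.
  by have := block_inl k; rewrite /= -E inE imset_f.
have block_surj B : B \in pi -> exists y, block y = B.
  move=> Bpi; have [/imsetP[j _ ->]|BS] := boolP (B \in S); first by exists (inr j).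
  have BD : B \in pi :\: S by rewrite inE BS.
  exists (inl (cast_ord cS (enum_rank_in BD B))).
  by rewrite /= cast_ordK enum_rankK_in.
have /fin_all_exists[g gP] (x : 'I_m) :
    exists y, block y = pblock pi (rshift q x).
  exact/block_surj/pblock_mem.
pose h : {ffun 'I_m -> 'I_p + 'I_q} := [ffun x => g x].
have ext x : block (extend_label h x) = pblock pi x.
  rewrite -[x]splitK; case: (split x) => y /=.
    by rewrite extend_label_lshift.
  by rewrite extend_label_rshift ffunE gP.
have fib y : fiber h y = block y.
  apply/setP => x; rewrite fiber_mem -(inj_eq block_inj) ext.
  apply/eqP/idP => [<-|xy]; first by rewrite mem_pblock.
  exact: def_pblock.
exists h.
  apply/forallP => i; have /set0Pn[x xi] : block (inl i) != set0.
    by apply: contraNneq s0 => <-.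
  move: xi; rewrite -fib fiber_mem -[x]splitK; case: (split x) => y /=.
    by rewrite extend_label_lshift.
  by rewrite extend_label_rshift => /eqP <-; apply: codom_f.
apply/setP => B; apply/imsetP/idP => [[y _ ->]|/block_surj[y <-]].
  by rewrite fib.
by exists y.
Qed.

(* Each partition is counted once for each of the p! ways of labelling its
   blocks disjoint from {1, ..., q}; the others are labelled by the element of
   {1, ..., q} that they contain. *)
Lemma rBell_labelled (R : comNzRingType) (a b : nat -> R) :
  rBell (q + m) (p + q) q a b *+ p`! =
  \sum_(h | covers_inl h)
    (\prod_i a #|[set x | h x == inl i]|) *
    (\prod_j b #|[set x | h x == inr j]|.+1).
Proof.
rewrite (partition_big fibers Bell_partition) /=; last exact: fibers_Bell.
rewrite /rBell -sumrMnl; apply: eq_bigr => pi /Bell_partition_fibers[h0 ch0 <-].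
rewrite -(card_fibers_eq ch0) -sumr_const; apply: eq_big => [h|h].
  by rewrite inE.
by rewrite inE => /andP[ch /eqP <-]; apply: fibers_weight.
Qed.

End LabelledPartitions.

(** * The Bell polynomial as a coefficient *)

Lemma rBell_coef (R : comNzRingType) (p q m M : nat) (a b : nat -> R) :
  (m < M)%N ->
  rBell (q + m) (p + q) q (fun l => (l`!)%:R * a l.-1)
    (fun l => (l.-1`!)%:R * b l.-1) *+ p`! =
  ('X^p * \prod_(y : 'I_p + 'I_q)
            \poly_(k < M) (if y is inl _ then a k else b k))`_m *+ m`!.
Proof.
move=> mM; rewrite rBell_labelled.
pose G (y : 'I_p + 'I_q) : {poly R} :=
  if y is inl _ then 'X * \poly_(k < M) a k else \poly_(k < M) b k.
have -> : 'X^p * \prod_(y : 'I_p + 'I_q)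
    \poly_(k < M) (if y is inl _ then a k else b k) = \prod_y G y.
  rewrite !big_sumType /= mulrA; congr (_ * _).
  by rewrite big_split /= !prodr_const card_ord.
(* Fibers have at most [m] elements, so truncation at [M] loses no coefficient. *)
have lt_fiber (h : {ffun 'I_m -> 'I_p + 'I_q}) y : (#|[set x | h x == y]| < M)%N.
  by apply: leq_ltn_trans mM; rewrite -[m in (_ <= m)%N]card_ord max_card.
rewrite -sum_fibers_coef big_mkcond; apply: eq_bigr => h _.
case: ifP => [/forallP ch|/forallPn[i hi]].
  rewrite big_sumType /=; congr (_ * _); apply: eq_bigr => k _.
    have : (0 < #|[set x | h x == inl k]|)%N.
      have /codomP[x hx] := ch k.
      by apply/card_gt0P; exists x; rewrite inE -hx.
    have := lt_fiber h (inl k); case: #|_| => // s sM _.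
    by rewrite coefXM coef_poly ltnW // mulr_natl.
  by rewrite coef_poly lt_fiber mulr_natl.
(* A labelling that misses [inl i] contributes zero, as the factor ['X] kills the constant
   coefficient. *)
rewrite (bigD1 (inl i)) //= (_ : [set x | _] = set0) ?cards0.
  by rewrite coefXM mul0rn mul0r.
by apply/setP => x; rewrite !inE; apply: contraNF hi => /eqP <-; apply: codom_f.
Qed.

(* The law of a sum of independent variables *)
From mathcomp Require Import all_classical all_reals all_analysis.

Local Open Scope classical_set_scope.
Local Open Scope ring_scope.

Lemma coef_prod_poly (R : comNzRingType) (I : finType) (M n : nat)
    (c : I -> nat -> R) :
  (\prod_i \poly_(k < M) c i k)`_n =
  \sum_(f : {ffun I -> 'I_M} | (\sum_i f i)%N == n) \prod_i c i (f i).
Proof.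
under eq_bigr => i _ do rewrite poly_def.
rewrite bigA_distr_bigA coef_sum [RHS]big_mkcond; apply: eq_bigr => f _.
rewrite scaler_prod prodrXr coefZ coefXn eq_sym.
by case: eqP => _; rewrite ?mulr1 ?mulr0.
Qed.

Lemma prob_sum_eq (d : measure_display) (T : measurableType d) (R : realType)
    (P : probability T R) (I : finType) (Z : I -> {RV P >-> nat})
    (c : I -> nat -> R) (M n : nat) :
  mutually_independent Z ->
  (forall i k, P [set w | Z i w = k] = (c i k)%:E) -> (n < M)%N ->
  P [set w | (\sum_i Z i w)%N = n] = ((\prod_i \poly_(k < M) c i k)`_n)%:E.
Proof.
move=> indZ cZ nM; rewrite coef_prod_poly.
pose F (f : {ffun I -> 'I_M}) :=
  \bigcap_(i in [set` [set: I]%SET]) (Z i @^-1` [set (f i : nat)]).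
pose r := [seq f : {ffun I -> 'I_M} <- enum {ffun I -> 'I_M} | (\sum_i f i)%N == n].
have -> : [set w | (\sum_i Z i w)%N = n] = \bigcup_(f in [set` r]) F f.
  apply/seteqP; split => w /=.
    move=> Zn.
    (* Each summand is at most the total [n], so finitely many value vectors suffice. *)
    have ZM i : (Z i w < M)%N.
      by apply: leq_ltn_trans nM; rewrite -Zn (bigD1 i) //= leq_addr.
    exists [ffun i => Ordinal (ZM i)].
      rewrite /= mem_filter mem_enum andbT -[X in _ == X]Zn.
      by apply/eqP/eq_bigr => i _; rewrite ffunE.
    by move=> i _ /=; rewrite ffunE.
  case=> f /=; rewrite mem_filter => /andP[/eqP fn _] Ff.
  by rewrite -fn; apply: eq_bigr => i _; apply: Ff; rewrite /= inE.
rewrite measure_fin_bigcup.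
- rewrite -fsbig_seq; last by rewrite filter_uniq ?enum_uniq.
  rewrite big_filter big_enum_cond /=.
  rewrite -sumEFin; apply: eq_bigr => f _.
  (* Independence is applied to the full index set and singleton events. *)
  rewrite indZ // -prodEFin.
  by apply: eq_big => i; rewrite ?inE // => _; rewrite -cZ.
- exact: finite_seq.
- move=> f g _ _ [w [Ff Fg]]; apply/ffunP => i; apply: val_inj.
  by rewrite /= -(Ff i) ?(Fg i) //= inE.
- move=> f _; apply: fin_bigcap_measurable => [|i _]; first exact: finite_finpred.
  exact: measurable_funPTI.
Qed.

Theorem theorem5 (d : measure_display) (T : measurableType d) (R : realType)
    (P : probability T R) (p q : nat)
    (X : 'I_p -> {RV P >-> nat}) (Y : 'I_q -> {RV P >-> nat})
    (px qy : nat -> R)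
    (hindep : mutually_independent (join_families X Y))
    (hX : forall (i : 'I_p) (j : nat), P [set w | X i w = j] = (px j)%:E)
    (hY : forall (i : 'I_q) (j : nat), P [set w | Y i w = j] = (qy j)%:E)
    (n : nat) :
  P [set w | (\sum_(i < p) X i w + \sum_(i < q) Y i w)%N = n] =
  ((p`!)%:R / ((n + p)`!)%:R *
   rBell (n + p + q) (p + q) q
     (fun l => (l`!)%:R * px l.-1)
     (fun l => (l.-1`!)%:R * qy l.-1))%:E.
Proof.
pose c (y : 'I_p + 'I_q) k := if y is inl _ then px k else qy k.
have cP y k : P [set w | join_families X Y y w = k] = (c y k)%:E.
  by case: y => i; [exact: hX | exact: hY].
(* The bound [(n + p).+1] exceeds both [n] and [n + p], so both sides use the same truncated
   polynomials. *)
have /(prob_sum_eq hindep cP) : (n < (n + p).+1)%N by rewrite ltnS leq_addr.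
under eq_set => w do rewrite big_sumType /=.
move=> ->; congr EFin.
have := @rBell_coef R p q (n + p) (n + p).+1 px qy (ltnSn _).
(* Removing ['X^p] lowers the index from [n + p] to [n]. *)
rewrite coefXnM ltnNge leq_addl /= addnK addnC => E.
have f0 k : (k`!)%:R != 0 :> R by rewrite pnatr_eq0 -lt0n fact_gt0.
by rewrite mulrAC mulr_natl E -[_ *+ (n + p)`!]mulr_natr mulfK.
Qed.
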